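(* Let $\mathbb{F}$ be a field and let $f\in\mathbb{F}[x_1,\ldots,x_n]$ be such that $f=\det(M)$ for some matrix $M$ with entries in $\{x_1,\ldots,x_n\}\cup\mathbb{F}$ in which each variable occurs in at most one position. Suppose $f$ is $n$-full, $(n-1)$-empty and $(n-2)$-empty. Then $f$ is not $k$-full for any $k$ with $\lfloor\frac{n-1}{2}\rfloor\le k<n$.
   Context: For a polynomial $f\in\mathbb{F}[x_1,\ldots,x_n]$ and an integer $k$, $f$ is called $k$-full if every multilinear monomial of degree $k$ (product of $k$ distinct variables among $x_1,\ldots,x_n$) has nonzero coefficient in $f$, and $k$-empty if no monomial of degree $k$ has nonzero coefficient in $f$. *)

(* Defs.v *)
From HB Require Import structures.
From mathcomp Require Import all_boot all_order all_algebra.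
From mathcomp Require Export mpoly.

Set Implicit Arguments.
Unset Strict Implicit.
Unset Printing Implicit Defensive.

Import Order.TTheory GRing.Theory Num.Theory.

Local Open Scope ring_scope.

(* The degree k ranges over int, so that "(n-1)-empty" and "(n-2)-empty"      *)
(* involve no truncated subtraction; at a negative k, where there are no      *)
(* monomials, both notions hold vacuously.                                    *)

Definition multilinear_mon (n : nat) (m : 'X_{1..n}) : Prop :=
  forall i : 'I_n, (m i <= 1)%N.

Definition k_full (F : fieldType) (n : nat) (f : {mpoly F[n]}) (k : int) :
    Prop :=
  forall m : 'X_{1..n}, multilinear_mon m -> (mdeg m)%:Z = k -> f@_m != 0.

Definition k_empty (F : fieldType) (n : nat) (f : {mpoly F[n]}) (k : int) :
    Prop :=
  forall m : 'X_{1..n}, (mdeg m)%:Z = k -> f@_m = 0.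

Definition entries_var_or_const (F : fieldType) (n d : nat)
    (M : 'M[{mpoly F[n]}]_d) : Prop :=
  forall i j : 'I_d,
    (exists l : 'I_n, M i j = 'X_l) \/ (exists c : F, M i j = c%:MP).

Definition vars_occur_at_most_once (F : fieldType) (n d : nat)
    (M : 'M[{mpoly F[n]}]_d) : Prop :=
  forall (l : 'I_n) (i j i' j' : 'I_d),
    M i j = 'X_l -> M i' j' = 'X_l -> i = i' /\ j = j'.

Definition read_once_det (F : fieldType) (n : nat) (f : {mpoly F[n]}) : Prop :=
  exists (d : nat) (M : 'M[{mpoly F[n]}]_d),
    [/\ entries_var_or_const M, vars_occur_at_most_once M & f = \det M].

(* Main.v *)
Require Import Defs.
From HB Require Import structures.
From mathcomp Require Import all_boot all_order all_algebra.
From mathcomp Require Import perm zify.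
From mathcomp Require Import mpoly.

(** Let [x_l] sit at position [(r l, c l)] of [M]; fullness in degree [n] makes
    [r] and [c] injective.  The coefficient of [\prod_(l in S) x_l] in [\det M]
    is the determinant of the constant matrix obtained from [M] by replacing
    each row [r l] with the unit vector at [c l] if [l \in S], and by setting
    the variables to 0 in the other rows.  For [S] the set of all variables
    this is an invertible matrix [K], and dividing by [K] on the right turns
    these determinants into the complementary principal minors of one constant
    matrix.  Emptiness in degrees [n-1] and [n-2] then says that its diagonal is
    zero and that of any two opposite entries one is zero, so counting yields a
    row with at least [n/2 + 1] zeros, one of them diagonal.  Any principal
    minor supported on zeros of that row, the diagonal one included,
    vanishes. *)

Set Implicit Arguments.
Unset Strict Implicit.
Unset Printing Implicit Defensive.

Import Order.TTheory GRing.Theory Num.Theory.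

Local Open Scope ring_scope.

(** For square matrices with [B] the identity, the determinant is the principal minor of [A] on [T],
    obtained without reindexing a submatrix. *)
Definition replace_rows (R : Type) (m n : nat) (T : {set 'I_m})
    (A B : 'M[R]_(m, n)) : 'M[R]_(m, n) :=
  \matrix_(i, j) if i \in T then A i j else B i j.

(** * Vanishing principal minors *)

Section PrincipalMinors.

Variables (F : fieldType) (d : nat).
Implicit Types (A B K : 'M[F]_d) (T : {set 'I_d}).

Lemma replace_rowsM T A B K :
  replace_rows T (A *m K) (B *m K) = replace_rows T A B *m K.
Proof.
apply/matrixP => i j; rewrite !mxE.
by case: ifP => iT; apply: eq_bigr => k _; rewrite !mxE iT.
Qed.

Lemma row_mul_replace_rows1 (v : 'rV[F]_d) T A j :
  (v *m replace_rows T A 1%:M) 0 j =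
  \sum_(i in T) v 0 i * A i j + (if j \in T then 0 else v 0 j).
Proof.
rewrite mxE (bigID (mem T)) /=; congr (_ + _).
  by apply: eq_bigr => i iT; rewrite mxE iT.
under eq_bigr => i iT do rewrite !mxE (negbTE iT).
case: ifP => jT.
  rewrite big1 // => i iT; case: eqP => [eij|_]; last by rewrite mulr0.
  by rewrite eij jT in iT.
rewrite (bigD1 j) ?jT //= eqxx mulr1 big1 ?addr0 // => i /andP[_ /negbTE ->].
by rewrite mulr0.
Qed.

Lemma det_replace_rows1_zero_row T A i :
  i \in T -> {in T, forall j, A i j = 0} ->
  \det (replace_rows T A 1%:M) = 0.
Proof.
move=> iT Ai0; apply/eqP/det0P.
(* This left kernel vector is the unit vector at [i] on [T]; its entries off [T] cancel row [i] of
   [A], which already vanishes on [T]. *)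
exists (\row_j if j \in T then (j == i)%:R else - A i j).
  apply/eqP => /rowP/(_ i); rewrite !mxE iT eqxx => /eqP.
  by rewrite oner_eq0.
apply/rowP => j; rewrite row_mul_replace_rows1 [RHS]mxE.
rewrite (bigD1 i) //= !mxE iT eqxx mul1r big1 ?addr0 => [|k /andP[kT ki]].
  by case: ifP => jT; [rewrite Ai0 ?addr0 | rewrite jT subrr].
by rewrite mxE kT (negbTE ki) mul0r.
Qed.

Lemma det_replace_rows1_set1 A i :
  \det (replace_rows [set i] A 1%:M) = 0 -> A i i = 0.
Proof.
move=> /eqP/det0P[v nz_v /rowP vA0].
have vA j : v 0 i * A i j + (if j == i then 0 else v 0 j) = 0.
  by have:= vA0 j; rewrite row_mul_replace_rows1 big_set1 in_set1 [RHS]mxE.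
have:= vA i; rewrite eqxx addr0 => /eqP; rewrite mulf_eq0 => /orP[/eqP vi0|/eqP //].
case/eqP: nz_v; apply/rowP => j; rewrite [RHS]mxE.
by have [-> //|ji] := eqVneq j i; have:= vA j; rewrite vi0 mul0r add0r (negbTE ji).
Qed.

Lemma det_replace_rows1_set2 A i j :
    i != j -> A i i = 0 -> A j j = 0 ->
  \det (replace_rows [set i; j] A 1%:M) = 0 -> A i j = 0 \/ A j i = 0.
Proof.
move=> nij Aii Ajj /eqP/det0P[v nz_v /rowP vA0].
have vA k : v 0 i * A i k + v 0 j * A j k +
    (if k \in [set i; j] then 0 else v 0 k) = 0.
  by have:= vA0 k; rewrite row_mul_replace_rows1 big_setU1 ?in_set1 //= big_set1 [RHS]mxE.
(* Column [i] gives [v 0 j * A j i = 0] and column [j] gives [v 0 i * A i j = 0]; if both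
   coordinates of [v] vanish, the other columns force [v = 0]. *)
have:= vA i; rewrite set21 Aii mulr0 add0r addr0 => /eqP.
rewrite mulf_eq0 => /orP[/eqP vj0|/eqP]; last by right.
have:= vA j; rewrite set22 Ajj mulr0 !addr0 => /eqP.
rewrite mulf_eq0 => /orP[/eqP vi0|/eqP]; last by left.
case/eqP: nz_v; apply/rowP => k; rewrite [RHS]mxE.
have:= vA k; rewrite vi0 vj0 !mul0r !add0r in_set2.
by have [-> //|] := eqVneq k i; have [-> //|] := eqVneq k j.
Qed.

End PrincipalMinors.

(** * Counting and choosing index sets *)

Lemma total_rel_card_row (T : finType) (Z : rel T) :
    (0 < #|T|)%N -> total Z ->
  exists x, (#|T| < (#|[set y | Z x y]|).*2)%N.
Proof.
move=> T_gt0 Zxy; have Zxx x : Z x x by have:= Zxy x x; rewrite orbb.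
have [/existsP //|] := boolP [exists x, #|T| < (#|[set y | Z x y]|).*2]%N.
rewrite negb_exists => /forallP small.
have zE x : #|[set y | Z x y]| = (\sum_y Z x y)%N.
  by rewrite cardsE -sum1_card big_mkcond.
(* Were every row at most half full, this double sum would be at most [#|T| * #|T|]; by totality
   each [x] contributes at least [#|T| + 1], the diagonal counting twice. *)
have: (\sum_x \sum_y (Z x y + Z y x) <= #|T| * #|T|)%N.
  under eq_bigr do rewrite big_split /=.
  rewrite big_split /= [X in (_ + X)%N]exchange_big /= addnn -muln2 big_distrl /=.
  rewrite -sum_nat_const leq_sum // => x _.
  by rewrite -zE muln2 leqNgt.
rewrite leqNgt => /negP[]; rewrite -sum_nat_const.
have lt_row x : (#|T| < \sum_y (Z x y + Z y x))%N.
  rewrite -sum1_card (bigD1 x) // [ltnRHS](bigD1 x) //= Zxx -addSn.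
  rewrite leq_add // leq_sum // => y _.
  by have:= Zxy x y; case: (Z x y) (Z y x) => [] [].
case/card_gt0P: T_gt0 => x0 _.
rewrite (bigD1 x0) // [ltnRHS](bigD1 x0) //= -addSn leq_add // leq_sum // => x _.
exact: ltnW.
Qed.

Lemma subset_card_mem (T : finType) (A : {set T}) (x : T) (m : nat) :
    x \in A -> (0 < m <= #|A|)%N ->
  exists B : {set T}, [/\ x \in B, B \subset A & #|B| = m].
Proof.
move=> xA /andP[m_gt0 mA].
have: (0 < #|[set B : {set T} | B \subset A :\ x & #|B| == m.-1]|)%N.
  by rewrite cards_draws bin_gt0; have:= cardsD1 x A; rewrite xA; lia.
case/card_gt0P => B; rewrite inE subsetD1 => /andP[/andP[BA xB] /eqP cB].
exists (x |: B); split; first exact: setU11.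
  by rewrite subUset sub1set xA.
by rewrite cardsU1 xB cB; lia.
Qed.

(** * Multilinear monomials as sets of variables *)

Definition mnm_of_set (n : nat) (S : {set 'I_n}) : 'X_{1..n} :=
  [multinom (l \in S : nat) | l < n].

Lemma mnm_of_set_multilinear (n : nat) (S : {set 'I_n}) :
  multilinear_mon (mnm_of_set S).
Proof. by move=> i; rewrite mnmE; case: (i \in S). Qed.

Lemma mdeg_mnm_of_set (n : nat) (S : {set 'I_n}) : mdeg (mnm_of_set S) = #|S|.
Proof.
by rewrite mdegE -sum1_card [RHS]big_mkcond; apply: eq_bigr => i _; rewrite mnmE.
Qed.

(** * Coefficients of the determinant *)

Section ReadOnceDet.

Variables (F : fieldType) (n d : nat) (M : 'M[{mpoly F[n]}]_d).
Hypothesis M_entries : entries_var_or_const M.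
Hypothesis M_once : vars_occur_at_most_once M.

(** Makes the product along any permutation a single term; the zero entry fits too, its [mleadc]
    being zero. *)
Lemma mlead_entry i j : M i j = (mleadc (M i j)) *: 'X_[mlead (M i j)].
Proof.
case: (M_entries i j) => [[l ->]|[c ->]].
  by rewrite mleadXm mcoeffX eqxx scale1r.
by rewrite mleadC mcoeffC eqxx mulr1 mpolyX0 alg_mpolyC.
Qed.

Lemma mlead_entry_neq0 i j l : (mlead (M i j) l != 0)%N -> M i j = 'X_l.
Proof.
case: (M_entries i j) => [[l' ->]|[c ->]]; last by rewrite mleadC mnm0E eqxx.
by rewrite mleadXm mnm1E; case: (l' =P l) => [->|].
Qed.

Lemma mcoeff_prod_entries (s : 'S_d) m :
  (\prod_i M i (s i))@_m =
  (\prod_i mleadc (M i (s i))) *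
    ((\sum_i mlead (M i (s i)))%MM == m)%:R.
Proof.
under eq_bigr do rewrite mlead_entry.
by rewrite scaler_prod mprodXE mcoeffZ mcoeffX.
Qed.

Lemma mcoeff_det m :
  (\det M)@_m = \sum_(s : 'S_d) (-1) ^+ s * (\prod_i M i (s i))@_m.
Proof.
rewrite /determinant raddf_sum /=; apply: eq_bigr => s _.
by case: (odd_perm s); rewrite ?expr0 ?expr1 ?mul1r ?mulN1r ?mcoeffN.
Qed.

(** Some permutation has a nonzero term in this coefficient, and its product can contain ['X_l] only
    by passing through an entry equal to ['X_l]. *)
Lemma full_transversal :
    (\det M)@_(mnm_of_set setT) != 0 ->
  exists (s : 'S_d) (r : 'I_n -> 'I_d), forall l, M (r l) (s (r l)) = 'X_l.
Proof.
move=> nz; have [s nz_s] : exists s : 'S_d,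
    (\prod_i M i (s i))@_(mnm_of_set setT) != 0.
  apply/existsP; apply: contra_neqT nz; rewrite negb_exists => /forallP z.
  rewrite mcoeff_det big1 // => s _.
  by have:= z s; rewrite negbK => /eqP ->; rewrite mulr0.
exists s; apply: (@fin_all_exists _ _ (fun l i => M i (s i) = 'X_l)) => l.
move: nz_s; rewrite mcoeff_prod_entries; case: (_ =P mnm_of_set _) => [/mnmP E|]; last first.
  by rewrite mulr0 eqxx.
move: (E l); rewrite mnm_sumE mnmE inE => sum1 _.
have [/existsP[i nz_i]|] := boolP [exists i, mlead (M i (s i)) l != 0]%N.
  by exists i; apply: mlead_entry_neq0.
rewrite negb_exists => /forallP z; move: sum1; rewrite big1 // => i _.
by have:= z i; rewrite negbK => /eqP.
Qed.

Variables (s0 : 'S_d) (r : 'I_n -> 'I_d).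
Hypothesis Mr : forall l, M (r l) (s0 (r l)) = 'X_l.

Lemma transversal_inj : injective r.
Proof.
move=> l l' e; have:= Mr l; rewrite e Mr => /(congr1 (@mlead _ _)).
by rewrite !mleadXm => /mnmP => /(_ l); rewrite !mnm1E eqxx; case: eqP.
Qed.

Let M0 : 'M[F]_d := \matrix_(i, j) (M i j)@_0%MM.
Let K : 'M[F]_d :=
  \matrix_(i, j) if i \in codom r then (s0 i == j)%:R else (M i j)@_0%MM.

(** The two sides agree permutation by permutation: a term survives only if [s] picks ['X_l] in row
    [r l] for [l] outside [T] and constants elsewhere. Rows outside [codom r] hold only
    constants. *)
Lemma mcoeff_det_replace_rows (T : {set 'I_n}) :
  (\det M)@_(mnm_of_set (~: T)) = \det (replace_rows (r @: T) M0 K).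
Proof.
have rT l : (r l \in r @: T) = (l \in T) by rewrite mem_imset //; apply: transversal_inj.
have rc l : r l \in codom r by apply: codom_f.
have XC l (c : F) : 'X_l <> c%:MP :> {mpoly F[n]}.
  by move=> /(congr1 (@mlead _ _)); rewrite mleadXm mleadC => /mnmP => /(_ l);
     rewrite mnm1E mnm0E eqxx.
rewrite mcoeff_det; apply: eq_bigr => s _; congr (_ * _).
rewrite mcoeff_prod_entries; case: eqP => [E|nE].
  rewrite mulr1; apply: eq_bigr => i _.
  have mle l : (mlead (M i (s i)) l <= (l \notin T))%N.
    move/mnmP: E => /(_ l); rewrite mnm_sumE mnmE inE => <-.
    by rewrite (bigD1 i) //= leq_addr.
  rewrite !mxE; case: (M_entries i (s i)) => [[l Ml]|[c Mc]].
    have [ei es] := M_once Ml (Mr l).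
    have:= mle l; rewrite Ml mleadXm mnm1E eqxx => lT.
    rewrite mcoeffX eqxx ei rT rc.
    have -> : (l \in T) = false by case: (l \in T) lT.
    by rewrite -es ei eqxx.
  (* A constant picked in row [r l] with [l] outside [T] would leave ['X_l] out of the product, its
     only position being in that row. *)
  rewrite Mc mleadC; do 2![case: ifP => //] => /codomP[l ei].
  rewrite ei rT => lT; exfalso.
  move/mnmP: E => /(_ l); rewrite mnm_sumE mnmE inE lT => sum1.
  have [/existsP[k /mlead_entry_neq0 Mk]|] :=
      boolP [exists k, mlead (M k (s k)) l != 0]%N.
    by have [ek _] := M_once Mk (Mr l); apply: (XC l c); rewrite -Mk ek -ei.
  rewrite negb_exists => /forallP z; move: sum1; rewrite big1 // => k _.
  by have:= z k; rewrite negbK => /eqP.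
(* Conversely, if [s] meets only nonzero entries of the constant matrix, it picks ['X_l] exactly for
   [l] outside [T], so the monomials match. *)
rewrite mulr0; apply/esym/eqP; apply/contra_notT: nE => /prodf_neq0 nz.
apply/mnmP => l; rewrite mnm_sumE mnmE inE.
have mE i : mlead (M i (s i)) l = ((i == r l) && (l \notin T))%N :> nat.
  have:= nz i isT; rewrite !mxE.
  case: (M_entries i (s i)) => [[l' Ml]|[c Mc]].
    have [ei es] := M_once Ml (Mr l').
    rewrite Ml mleadXm mnm1E mcoeffX {1 2 3}ei rT rc ei.
    rewrite (inj_eq transversal_inj).
    case: ifP => [_|l'T _]; last by case: eqP => // <-; rewrite l'T.
    by rewrite -[_ == 0%MM]mdeg_eq0 mdeg1 eqxx.
  rewrite Mc mleadC mnm0E; case: (i =P r l) => //= ei; rewrite ei rT rc.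
  case: (boolP (l \in T)) => //= lT.
  case: (s0 (r l) =P _) => [es _|]; last by rewrite eqxx.
  by case: (XC l c); rewrite -Mc -(Mr l) ei es.
under eq_bigr do rewrite mE.
by rewrite (bigD1 (r l)) //= eqxx big1 ?addn0 // => i /negbTE ->.
Qed.

Lemma read_once_det_minors :
    (\det M)@_(mnm_of_set setT) != 0 ->
  exists A : 'M[F]_d, forall T : {set 'I_n},
    ((\det M)@_(mnm_of_set (~: T)) == 0) =
    (\det (replace_rows (r @: T) A 1%:M) == 0).
Proof.
rewrite -setC0 mcoeff_det_replace_rows imset0.
have -> : replace_rows set0 M0 K = K by apply/matrixP=> i j; rewrite !mxE inE.
move=> nzK; have uK : K \in unitmx by rewrite unitmxE unitfE.
exists (M0 *m invmx K) => T.
rewrite mcoeff_det_replace_rows -{1}(mul1mx K) -{1}(mulmxKV uK M0).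
by rewrite replace_rowsM det_mulmx mulf_eq0 (negbTE nzK) orbF.
Qed.

End ReadOnceDet.

Theorem theorem6 (F : fieldType) (n : nat) (n_gt0 : (0 < n)%N)
    (f : {mpoly F[n]})
    (f_det : read_once_det f)
    (f_full : k_full f n%:Z)
    (f_empty1 : k_empty f (n%:Z - 1))
    (f_empty2 : k_empty f (n%:Z - 2))
    (k : int) (k_ge : ((n%:Z - 1) %/ 2)%Z <= k) (k_lt : k < n%:Z) :
  ~ k_full f k.
Proof.
case: f_det => d [M [M_entries M_once fE]] f_kfull.
have cardC (T : {set 'I_n}) : (#|T| + #|~: T| = n)%N by rewrite cardsC card_ord.
have fT : (\det M)@_(mnm_of_set setT) != 0.
  rewrite -fE; apply: f_full; first exact: mnm_of_set_multilinear.
  by rewrite mdeg_mnm_of_set cardsT card_ord.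
have [s [r Mr]] := full_transversal M_entries fT.
have r_inj := transversal_inj Mr.
have [A minorE] := read_once_det_minors M_entries M_once Mr fT.
rewrite -fE in minorE.
have A1 l : A (r l) (r l) = 0.
  apply: det_replace_rows1_set1; apply/eqP; rewrite -imset_set1 -minorE.
  apply/eqP/f_empty1; rewrite mdeg_mnm_of_set.
  by have:= cardC [set l]; rewrite cards1; lia.
have A2 l l' : (A (r l) (r l') == 0) || (A (r l') (r l) == 0).
  have [<-|nll'] := eqVneq l l'; first by rewrite A1 eqxx.
  have: A (r l) (r l') = 0 \/ A (r l') (r l) = 0.
    apply: det_replace_rows1_set2; rewrite ?A1 ?(inj_eq r_inj) //.
    apply/eqP; rewrite -!imset_set1 -imsetU -minorE.
    apply/eqP/f_empty2; rewrite mdeg_mnm_of_set.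
    by have:= cardC [set l; l']; rewrite cards2 nll'; lia.
  by case=> ->; rewrite eqxx ?orbT.
have [|l] := @total_rel_card_row 'I_n (fun l l' => A (r l) (r l') == 0) _ A2.
  by rewrite card_ord.
set Z := [set _ | _]; rewrite card_ord => cardZ.
have lZ : l \in Z by rewrite inE A1.
(* The bounds on [k] give [0 < n - k <= n./2 + 1], and [cardZ] gives [n./2 + 1 <= #|Z|]; positivity
   leaves room for [l] in [T]. *)
have [|T [lT TZ cT]] := @subset_card_mem _ Z l `|n%:Z - k|%N lZ; first by lia.
have:= f_kfull (mnm_of_set (~: T)) (@mnm_of_set_multilinear _ _).
rewrite mdeg_mnm_of_set minorE => nz.
have /negP[] := nz ltac:(have:= cardC T; lia).
apply/eqP/(@det_replace_rows1_zero_row _ _ _ _ (r l)); first exact: imset_f.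
by move=> _ /imsetP[l' l'T ->]; have:= subsetP TZ l' l'T; rewrite inE => /eqP.
Qed.
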